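(* For every admissible algebra $\mathcal N$ one has $\dim\mathrm{Aut}(\mathcal N)\ge\dim\mathcal N/\mathcal N^4$. The same lower bound holds for the dimension of $\mathrm{der}(\mathcal N)$.
   Context: $\mathbb F$ is a field of characteristic $0$; all algebras are associative $\mathbb F$-algebras. For an algebra $\mathcal N$ put $\mathcal N^1=\mathcal N$ and let $\mathcal N^{k+1}$ be the linear span of $\mathcal N\mathcal N^k$; $\mathcal N$ is nilpotent if $\mathcal N^{k+1}=0$ for some $k$. An admissible algebra is a commutative nilpotent algebra $\mathcal N$ of finite dimension over $\mathbb F$ whose annihilator $\{x\in\mathcal N:x\mathcal N=0\}$ has dimension $1$. $\mathrm{Aut}(\mathcal N)$ is the algebra automorphism group of $\mathcal N$ (a linear algebraic group over $\mathbb F$, contained in $\mathrm{GL}(\mathcal N)$) and $\mathrm{der}(\mathcal N)$ the Lie algebra of derivations of $\mathcal N$. *)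

(* Defs.v *)
From Stdlib Require Import ClassicalEpsilon.
From HB Require Import structures.
From mathcomp Require Import all_boot all_order all_algebra.
From mathcomp.multinomials Require Import mpoly.

Set Implicit Arguments.
Unset Strict Implicit.
Unset Printing Implicit Defensive.

Import GRing.Theory.
Local Open Scope ring_scope.

(* The algebras below have no unit, so they do not fit falgType.  A finite
   dimensional algebra is a vector space N : vectType F together with a
   product mul : {bilinear N -> N -> N}. *)

Section Algebra.
Variables (F : fieldType) (N : vectType F) (mul : {bilinear N -> N -> N}).

(* Same construction as prodv for unital algebras; see prodspP. *)
Definition prods (U V : {vspace N}) : {vspace N} :=
  <<[seq mul u v | u <- vbasis U, v <- vbasis V]>>%VS.

Lemma memv_prods (U V : {vspace N}) u v :
  u \in U -> v \in V -> mul u v \in prods U V.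
Proof.
move=> Uu Vv; rewrite (coord_vbasis Uu) (coord_vbasis Vv) linear_sumlz /=.
apply: memv_suml => i _; rewrite linear_sumr; apply: memv_suml => j _.
rewrite linearZl_LR linearZr_LR /= !memvZ // memv_span //.
by apply: allpairs_f; apply: memt_nth.
Qed.

Lemma prodspP (U V W : {vspace N}) :
  reflect (forall u v, u \in U -> v \in V -> mul u v \in W)
          (prods U V <= W)%VS.
Proof.
apply: (iffP idP) => [sUVW u v Uu Vv | sUVW].
  by apply: subvP sUVW _ _; apply: memv_prods.
apply/span_subvP => _ /allpairsP[[u v] /= [Uu Vv ->]].
by apply: sUVW; apply: vbasis_mem.
Qed.

(* pows k is N^k for k >= 1; pows 0 is a junk value. *)
Fixpoint pows (k : nat) : {vspace N} :=
  match k with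
  | 0 | 1 => fullv
  | k'.+1 => prods fullv (pows k')
  end.

Definition nilpotent_alg : Prop := exists k, pows k.+1 = 0%VS.

Definition annihilator : {vspace N} :=
  (\bigcap_(i < \dim {:N}) lker (linfun (mul^~ (vbasis {:N})`_i)))%VS.

Lemma annihilatorP x :
  reflect (forall y, mul x y = 0) (x \in annihilator).
Proof.
have linE y : linfun (mul^~ y) x = mul x y.
  by rewrite (@lfunE _ _ _ (applyr mul y)).
rewrite memvE; apply: (iffP subv_bigcapP) => [ann_x y | ann_x i _].
  rewrite (coord_vbasis (memvf y)) linear_sumr big1 // => i _.
  have := ann_x i isT; rewrite -memvE memv_ker linE => /eqP xi0.
  by rewrite linearZr_LR /= xi0 scaler0.
by rewrite -memvE memv_ker linE ann_x.
Qed.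

Definition admissible : Prop :=
  [/\ forall x y z, mul x (mul y z) = mul (mul x y) z,
      forall x y, mul x y = mul y x,
      nilpotent_alg
    & \dim annihilator = 1%N].

Definition is_automorphism (g : 'End(N)) : Prop :=
  bijective g /\ forall x y, g (mul x y) = mul (g x) (g y).

Definition is_derivation (D : 'End(N)) : Prop :=
  forall x y, D (mul x y) = mul (D x) y + mul x (D y).

Definition leibniz_defect (x y : N) (D : 'End(N)) : N :=
  D (mul x y) - (mul (D x) y + mul x (D y)).

Lemma leibniz_defect_is_linear x y : linear (leibniz_defect x y).
Proof.
move=> a D E; rewrite /leibniz_defect !lfunE /= !lfunE /=.
rewrite linearDl linearDr linearZl_LR linearZr_LR /=.
by rewrite scalerBr scalerDr (addrACA (a *: _)) opprD addrACA.
Qed.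

HB.instance Definition _ x y :=
  GRing.isLinear.Build F 'End(N) N *:%R (leibniz_defect x y)
    (leibniz_defect_is_linear x y).

Definition der : {vspace 'End(N)} :=
  (\bigcap_(i < \dim {:N}) \bigcap_(j < \dim {:N})
     lker (linfun (leibniz_defect (vbasis {:N})`_i (vbasis {:N})`_j)))%VS.

Lemma derP D : reflect (is_derivation D) (D \in der).
Proof.
rewrite memvE; apply: (iffP subv_bigcapP) => [derD x y | derD i _].
  rewrite (coord_vbasis (memvf x)) (coord_vbasis (memvf y)).
  rewrite !linear_sumlz !(linear_sum D) linear_sumlz -big_split /=.
  apply: eq_bigr => i _; rewrite !(linear_sumr mul) !(linear_sum D).
  rewrite -big_split /=; apply: eq_bigr => j _.
  rewrite ?(linearZl_LR mul, linearZr_LR mul, linearZ_LR D).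
  have /subv_bigcapP/(_ j isT) := derD i isT.
  rewrite -memvE memv_ker lfunE /= /leibniz_defect subr_eq0 => /eqP ->.
  by rewrite /= !scalerDr (scalerA (coord _ j y)) mulrC -scalerA.
apply/subv_bigcapP => j _.
by rewrite -memvE memv_ker lfunE /= /leibniz_defect derD subrr.
Qed.

End Algebra.

(* Extended natural numbers: None is infinity. *)
Definition le_enat (d e : option nat) : Prop :=
  match d, e with
  | _, None => True
  | None, Some _ => False
  | Some m, Some n => (m <= n)%N
  end.

Definition is_enat_sup (A : nat -> Prop) (s : option nat) : Prop :=
  (forall n, A n -> le_enat (Some n) s) /\
  (forall e, (forall n, A n -> le_enat (Some n) e) -> le_enat s e).

Definition enat_sup (A : nat -> Prop) : option nat :=
  epsilon (inhabits None) (is_enat_sup A).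

Lemma enat_supP (A : nat -> Prop) : is_enat_sup A (enat_sup A).
Proof.
apply: epsilon_spec.
have [[b Ab]|unbA] := classic (exists b, forall n, A n -> (n <= b)%N).
  elim: b Ab => [|b IHb] Ab.
    by exists (Some 0%N); split=> // -[].
  have [Ab1|nAb1] := classic (A b.+1).
    by exists (Some b.+1); split=> // e /(_ _ Ab1).
  apply: IHb => n An; have := Ab n An; rewrite leq_eqVlt => /orP[/eqP En|//].
  by case: nAb1; rewrite -En.
exists None; split=> // -[b|] // Ab.
by case: unbA; exists b.
Qed.

(* The spectrum of the quotient ring R / I consists of the prime ideals of R
   containing I; quot_krull_dim I is the Krull dimension of R / I, for a proper
   ideal I.  As idealr_closed and prime_idealr_closed require, ideals P i are
   boolean predicates; this is no restriction with classical logic. *)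
Definition prime_chain (R : comNzRingType) (I : R -> Prop) (d : nat) : Prop :=
  exists P : nat -> {pred R},
    (forall i, (i <= d)%N ->
       [/\ idealr_closed (P i), prime_idealr_closed (P i)
         & forall a, I a -> a \in P i]) /\
    (forall i, (i < d)%N ->
       {subset P i <= P i.+1} /\ exists2 a, a \in P i.+1 & a \notin P i).

Definition quot_krull_dim (R : comNzRingType) (I : R -> Prop) : option nat :=
  enat_sup (prime_chain I).

(* The ring of polynomial functions of a vector space V, presented by the
   coordinates in a basis of V, and the ideal of those vanishing on Z. *)
Definition vanishing_ideal (F : fieldType) (V : vectType F) (Z : V -> Prop)
    (p : {mpoly F[\dim {:V}]}) : Prop :=
  forall v, Z v -> p.@[fun i => coord (vbasis {:V}) i v] = 0.

(* Dimension of a Zariski closed subset Z of V: the Krull dimension of its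
   coordinate ring F[V] / I(Z). *)
Definition alg_dim (F : fieldType) (V : vectType F) (Z : V -> Prop)
  : option nat := quot_krull_dim (@vanishing_ideal F V Z).

(* GL(V) is an affine variety through the closed embedding g |-> (g, g^-1) in
   End(V) x End(V).  The coordinate ring so obtained is the usual one, generated
   by the entries of g and det(g)^-1: the entries of g^-1 are cofactors of g
   times det(g)^-1, and conversely det(g)^-1 = det(g^-1). *)
Definition GL_embed (F : fieldType) (V : vectType F) (G : 'End(V) -> Prop)
    (u : 'End(V) * 'End(V)) : Prop :=
  G u.1 /\ u.2 = (u.1^-1)%VF.

(* Dimension of a linear algebraic group G contained in GL(V). *)
Definition alg_group_dim (F : fieldType) (V : vectType F)
    (G : 'End(V) -> Prop) : option nat :=
  alg_dim (GL_embed G).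

(* Main.v *)
Require Import Defs.
From Stdlib Require Import Classical ClassicalEpsilon.
From HB Require Import structures.
From mathcomp Require Import all_boot all_order all_algebra.
From mathcomp Require Import ring.
From mathcomp.multinomials Require Import mpoly.

(* Let s span the annihilator and let w be a functional with w(s) = 1.  Every
   nonzero ideal contains s, so an endomorphism D is determined by the values
   w(D a) and w(b D a), and the latter can be prescribed freely up to the
   constraint at b = s.  Given a functional mu vanishing on N^4, prescribe
   w(D a) = mu(a) and w(b D a) = j / (i + j) mu(b a) for a of weight j and b of
   weight i, the weights being those of the filtration N, N^2, N^3.  The result
   is a derivation, and w o D = mu gives dim der(N) >= dim N / N^4.

   If moreover mu(s) = 0, then D maps N, Ann(N^3), Ann(N^2), Ann(N) each into
   the next one and kills the last, so exp(D) is an automorphism, and mu is a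
   polynomial in the entries of exp(D) and exp(-D).  Hence the functionals mu
   in a decreasing flag of subspaces give a chain of irreducible subsets of
   Aut(N) with distinct closures.  Only when N^4 = 0 is mu(s) = 0 a restriction;
   then the derivation obtained from mu = w has its eigenvalues among 1/3, 1/2,
   2/3, 1 and is semisimple, and the torus it generates adds one more step to
   the chain. *)

Set Implicit Arguments.
Unset Strict Implicit.
Unset Printing Implicit Defensive.

Import GRing.Theory.
Local Open Scope ring_scope.

(** * Linear functionals as tests for equality of vectors *)

Section Functionals.
Variables (F : fieldType) (V : vectType F).

(* Values of a linear functional, typed in F rather than F^o so that ring and
   field apply. *)
Definition ev (f : 'Hom(V, F^o)) (x : V) : F := f x.

Lemma ev0 f : ev f 0 = 0. Proof. by rewrite /ev linear0. Qed.
Lemma evD f x y : ev f (x + y) = ev f x + ev f y.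
Proof. by rewrite /ev linearD. Qed.
Lemma evN f x : ev f (- x) = - ev f x. Proof. by rewrite /ev linearN. Qed.
Lemma evB f x y : ev f (x - y) = ev f x - ev f y.
Proof. by rewrite /ev linearB. Qed.
Lemma evZ f c x : ev f (c *: x) = c * ev f x.
Proof. by rewrite /ev linearZ. Qed.
Lemma ev_sum f I (r : seq I) P (G : I -> V) :
  ev f (\sum_(i <- r | P i) G i) = \sum_(i <- r | P i) ev f (G i).
Proof. by rewrite /ev linear_sum. Qed.
Lemma evDl f g x : ev (f + g) x = ev f x + ev g x.
Proof. by rewrite /ev add_lfunE. Qed.
Lemma evZl f c x : ev (c *: f) x = c * ev f x.
Proof. by rewrite /ev scale_lfunE. Qed.

Definition evE := (ev0, evB, evD, evN, evZ).

Lemma linear_functionalP (f : V -> F) :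
    (forall c x y, f (c *: x + y) = c * f x + f y) ->
  exists g, forall x, ev g x = f x.
Proof.
move=> lin_f.
pose Lf := GRing.isLinear.Build F V F^o *:%R f lin_f.
pose f' : {linear V -> F^o} := HB.pack f Lf.
by exists (linfun f') => x; rewrite /ev (lfunE f').
Qed.

Lemma coord_functional n (X : n.-tuple V) (i : 'I_n) :
  exists g, forall x, ev g x = coord X i x.
Proof. by apply: linear_functionalP => c x y; rewrite linearP. Qed.

Lemma coord_vbasisf x :
  x = \sum_i coord (vbasis {:V}) i x *: (vbasis {:V})`_i.
Proof. exact: coord_vbasis (memvf x). Qed.

(** Reduces identities between vectors to identities in [F], where [ring] and [field] apply. *)
Lemma ev_inj x y : (forall f, ev f x = ev f y) -> x = y.
Proof.
move=> eq_xy; rewrite (coord_vbasisf x) (coord_vbasisf y).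
apply: eq_bigr => i _; have [g gE] := coord_functional (vbasis {:V}) i.
by rewrite -!gE eq_xy.
Qed.

End Functionals.

(** * Polynomial functions and irreducible sets *)

Lemma natS_neq0 (F : fieldType) (charF0 : [pchar F] =i pred0) n :
  (n.+1%:R : F) != 0.
Proof. by rewrite (iffLR (pcharf0P F) charF0). Qed.

(** In characteristic 0 the naturals below [size P] are distinct in [F], and they outnumber the
    roots of [P]. *)
Lemma poly_nonroot (F : fieldType) (charF0 : [pchar F] =i pred0)
    (P : {poly F}) : P != 0 -> exists t, P.[t] != 0.
Proof.
move=> P0; pose rs : seq F := [seq i%:R | i <- iota 0 (size P)].
have inj_nat : injective (fun i => i%:R : F).
  suff le_inj i j : (i <= j)%N -> i%:R = j%:R :> F -> i = j.
    by move=> i j /= ij; case/orP: (leq_total i j) => /le_inj->.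
  move=> le_ij /esym/eqP.
  rewrite -subr_eq0 -natrB // (iffLR (pcharf0P F) charF0).
  by rewrite subn_eq0 => le_ji; apply/eqP; rewrite eqn_leq le_ij.
have Urs : uniq rs by rewrite map_inj_uniq ?iota_uniq.
have [all_rs|] := boolP (all (root P) rs).
  by have := max_poly_roots P0 all_rs Urs; rewrite size_map size_iota ltnn.
by case/allPn => t _ Pt; exists t.
Qed.

Section Geometry.
Variables (F : fieldType) (V : vectType F).
Implicit Types (p q : {mpoly F[\dim {:V}]}) (C Z : V -> Prop).

Definition pval p v : F := p.@[fun i => coord (vbasis {:V}) i v].

Definition polyfun (f : V -> F) := exists p, forall v, pval p v = f v.

Lemma polyfun_const c : polyfun (fun=> c).
Proof. by exists c%:MP => v; rewrite /pval mevalC. Qed.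

Lemma polyfunD f g : polyfun f -> polyfun g -> polyfun (fun v => f v + g v).
Proof.
by move=> [p pE] [q qE]; exists (p + q) => v; rewrite -pE -qE /pval mevalD.
Qed.

Lemma polyfunM f g : polyfun f -> polyfun g -> polyfun (fun v => f v * g v).
Proof.
by move=> [p pE] [q qE]; exists (p * q) => v; rewrite -pE -qE /pval mevalM.
Qed.

Lemma polyfun_sum n (f : 'I_n -> V -> F) :
  (forall i, polyfun (f i)) -> polyfun (fun v => \sum_i f i v).
Proof.
move=> fP; have /all_sig[p pE] : forall i, {p | forall v, pval p v = f i v}.
  by move=> i; exact: constructive_indefinite_description (fP i).
exists (\sum_i p i) => v; rewrite /pval (big_morph _ (mevalD _) (meval0 _)).
by apply: eq_bigr => i _; apply: pE.
Qed.

Lemma polyfun_ev (g : 'Hom(V, F^o)) : polyfun (ev g).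
Proof.
exists (\sum_(i < \dim {:V}) (ev g (vbasis {:V})`_i) *: 'X_i) => v.
rewrite /pval (big_morph _ (mevalD _) (meval0 _)) {2}(coord_vbasisf v) ev_sum.
by apply: eq_bigr => i _; rewrite mevalZ mevalXU evZ mulrC.
Qed.

(** For nonempty [C] this says that the Zariski closure of [C] is irreducible; [C] itself may fail
    to be closed. *)
Definition irreducible_set C :=
  forall p q, vanishing_ideal C (p * q) ->
    vanishing_ideal C p \/ vanishing_ideal C q.

(** The vanishing ideals of the [C i] increase with [i]; they are prime by irreducibility, proper by
    nonemptiness, and the functions [f] make the inclusions strict. *)
Lemma krull_dim_ge Z d (C : nat -> V -> Prop) :
    (forall i v, (i <= d)%N -> C i v -> Z v) ->
    (forall i, (i <= d)%N -> exists v, C i v) ->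
    (forall i, (i <= d)%N -> irreducible_set (C i)) ->
    (forall i v, (i < d)%N -> C i.+1 v -> C i v) ->
    (forall i, (i < d)%N -> exists f,
       [/\ polyfun f, forall v, C i.+1 v -> f v = 0
         & exists2 v, C i v & f v != 0]) ->
  le_enat (Some d) (alg_dim Z).
Proof.
move=> CZ C0 irrC decrC sepC.
pose P i : {pred {mpoly F[\dim {:V}]}} := fun p =>
  if excluded_middle_informative (vanishing_ideal (C i) p) then true else false.
have PP i p : reflect (vanishing_ideal (C i) p) (p \in P i).
  by rewrite unfold_in; case: excluded_middle_informative => ?; constructor.
apply: (enat_supP _).1; exists P; split=> i le_id.
  split.
  - split; first by apply/PP => v _; rewrite meval0.
      apply/PP => P1; have [v Cv] := C0 i le_id.
      by have /eqP := P1 v Cv; rewrite meval1 oner_eq0.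
    move=> a p q /PP Pp /PP Pq; apply/PP => v Cv.
    by rewrite mevalD mevalM Pp // Pq // mulr0 addr0.
  - move=> p q /PP /(irrC i le_id)[] H; apply/orP; [left | right];
      exact/PP.
  - by move=> p Ip; apply/PP => v /(CZ i v le_id); apply: Ip.
split=> [p /PP Pp|]; first by apply/PP => v /(decrC i v le_id); apply: Pp.
have [f [[p pE] f0 [v Cv fv]]] := sepC i le_id.
exists p; first by apply/PP => u Cu; rewrite -[LHS]/(pval p u) pE f0.
by apply/PP => /(_ v Cv); rewrite -[LHS]/(pval p v) pE => /eqP; apply/negP.
Qed.

End Geometry.

(* Restrictions to the nonzero locus of h of functions of F[t][1/h]. *)
Definition ratfun (F : fieldType) (h : {poly F}) (k : F -> F) :=
  exists e (P : {poly F}), forall t, h.[t] != 0 -> h.[t] ^+ e * k t = P.[t].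

(** * Rational functions of one variable and rational curves *)

Section RationalFunctions.
Variables (F : fieldType) (h : {poly F}).

Lemma ratfun_poly (P : {poly F}) : ratfun h (horner P).
Proof. by exists 0%N, P => t _; rewrite mul1r. Qed.

Lemma eq_ratfun k l : k =1 l -> ratfun h k -> ratfun h l.
Proof. by move=> kl [e [P PE]]; exists e, P => t /PE<-; rewrite kl. Qed.

Lemma ratfun_const c : ratfun h (fun=> c).
Proof. by apply: (eq_ratfun _ (ratfun_poly c%:P)) => t; rewrite hornerC. Qed.

Lemma ratfun_id : ratfun h id.
Proof. by apply: (eq_ratfun _ (ratfun_poly 'X)) => t; rewrite hornerX. Qed.

Lemma ratfunV : ratfun h (fun t => h.[t]^-1).
Proof. by exists 1%N, 1 => t ht; rewrite expr1 hornerC mulfV. Qed.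

Lemma ratfunD k l : ratfun h k -> ratfun h l -> ratfun h (fun t => k t + l t).
Proof.
move=> [d [P PE]] [e [Q QE]].
exists (d + e)%N, (h ^+ e * P + h ^+ d * Q) => t ht.
by rewrite hornerD !hornerM !horner_exp -PE -?QE // exprD; ring.
Qed.

Lemma ratfunM k l : ratfun h k -> ratfun h l -> ratfun h (fun t => k t * l t).
Proof.
move=> [d [P PE]] [e [Q QE]]; exists (d + e)%N, (P * Q) => t ht.
by rewrite hornerM -PE -?QE // exprD; ring.
Qed.

Lemma ratfunX k n : ratfun h k -> ratfun h (fun t => k t ^+ n).
Proof.
move=> kP; elim: n => [|n IHn]; first exact: ratfun_const.
by apply: (eq_ratfun _ (ratfunM kP IHn)) => t; rewrite exprS.
Qed.

Lemma ratfun_sum n (k : 'I_n -> F -> F) :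
  (forall i, ratfun h (k i)) -> ratfun h (fun t => \sum_i k i t).
Proof.
elim: n k => [|n IHn] k kP.
  by apply: (eq_ratfun _ (ratfun_const 0)) => t; rewrite big_ord0.
by apply: (eq_ratfun _ (ratfunD (kP 0) (IHn _ (fun i => kP (lift 0 i))))) => t;
   rewrite big_ord_recl.
Qed.

(** Regularity away from the zeros of [h], stated without coordinates; at those zeros the curve is
    unconstrained. *)
Definition ratcurve (W : vectType F) (c : F -> W) :=
  forall g : 'Hom(W, F^o), ratfun h (fun t => ev g (c t)).

Lemma ratcurve_const (W : vectType F) (w : W) : ratcurve (fun=> w).
Proof. by move=> g; apply: ratfun_const. Qed.

Lemma ratcurveD (W : vectType F) (c d : F -> W) :
  ratcurve c -> ratcurve d -> ratcurve (fun t => c t + d t).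
Proof.
by move=> cP dP g; apply: (eq_ratfun _ (ratfunD (cP g) (dP g))) => t;
   rewrite evD.
Qed.

Lemma ratcurveZ (W : vectType F) k (c : F -> W) :
  ratfun h k -> ratcurve c -> ratcurve (fun t => k t *: c t).
Proof.
by move=> kP cP g; apply: (eq_ratfun _ (ratfunM kP (cP g))) => t; rewrite evZ.
Qed.

Lemma ratcurve_linear (U W : vectType F) (f : U -> W) c :
  linear f -> ratcurve c -> ratcurve (fun t => f (c t)).
Proof.
move=> lin_f cP g.
have [gf gfE] : exists gf : 'Hom(U, F^o), forall x, ev gf x = ev g (f x).
  by apply: linear_functionalP => a x y; rewrite lin_f evD evZ.
by apply: (eq_ratfun _ (cP gf)) => t; rewrite gfE.
Qed.

Lemma ratcurve_pair (U W : vectType F) (c : F -> U) (d : F -> W) :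
  ratcurve c -> ratcurve d -> ratcurve (fun t => (c t, d t)).
Proof.
move=> cP dP.
have cP1 : ratcurve (fun t => (c t, 0 : W)).
  by apply: (ratcurve_linear (f := fun x => (x, 0)) _ cP) => a x y;
     congr pair; rewrite /= scaler0 addr0.
have dP1 : ratcurve (fun t => (0 : U, d t)).
  by apply: (ratcurve_linear (f := fun x => (0, x)) _ dP) => a x y;
     congr pair; rewrite /= scaler0 addr0.
move=> g; apply: (eq_ratfun _ (ratcurveD cP1 dP1 g)) => t.
by congr ev; congr pair; rewrite /= ?addr0 ?add0r.
Qed.

Lemma ratcurve_comp (W : vectType F) (c d : F -> 'End(W)) :
  ratcurve c -> ratcurve d -> ratcurve (fun t => c t \o d t)%VF.
Proof.
move=> cP dP g; pose e := vbasis {: 'End(W)}.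
pose k t := \sum_i \sum_j
  coord e i (c t) * coord e j (d t) * ev g (e`_i \o e`_j)%VF.
have kP : ratfun h k.
  apply: ratfun_sum => i; apply: ratfun_sum => j.
  apply: ratfunM (ratfun_const _); apply: ratfunM.
    have [f fE] := coord_functional e i.
    by apply: (eq_ratfun _ (cP f)) => t; rewrite fE.
  have [f fE] := coord_functional e j.
  by apply: (eq_ratfun _ (dP f)) => t; rewrite fE.
have linl (Y : 'End(W)) : exists f, forall X, ev f X = ev g (X \o Y)%VF.
  by apply: linear_functionalP => a X X';
     rewrite comp_lfunDl -comp_lfunZl evD evZ.
have linr (X : 'End(W)) : exists f, forall Y, ev f Y = ev g (X \o Y)%VF.
  by apply: linear_functionalP => a Y Y';
     rewrite comp_lfunDr -comp_lfunZr evD evZ.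
apply: (eq_ratfun _ kP) => t; rewrite /k.
have [fl flE] := linl (d t); rewrite -flE {2}(coord_vbasisf (c t)) ev_sum.
apply: eq_bigr => i _; rewrite evZ flE; have [fr frE] := linr e`_i.
rewrite -frE {2}(coord_vbasisf (d t)) ev_sum mulr_sumr.
by apply: eq_bigr => j _; rewrite evZ frE mulrA.
Qed.

Lemma ratfun_pval (W : vectType F) (c : F -> W) p :
  ratcurve c -> ratfun h (fun t => pval p (c t)).
Proof.
move=> cP; elim/mpolyind: p => [|a m p _ _ IHp].
  by apply: (eq_ratfun _ (ratfun_const 0)) => t; rewrite /pval meval0.
have mP : ratfun h (fun t => pval 'X_[m] (c t)).
  have prodP (r : seq 'I_(\dim {:W})) : ratfun h (fun t =>
      \prod_(i <- r) coord (vbasis {:W}) i (c t) ^+ m i).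
    elim: r => [|i r IHr].
      by apply: (eq_ratfun _ (ratfun_const 1)) => t; rewrite big_nil.
    have [f fE] := coord_functional (vbasis {:W}) i.
    apply: (eq_ratfun _ (ratfunM (ratfunX (m i) (cP f)) IHr)) => t.
    by rewrite big_cons fE.
  by apply: (eq_ratfun _ (prodP _)) => t; rewrite /pval mevalX.
apply: (eq_ratfun _ (ratfunD (ratfunM (ratfun_const a) mP) IHp)) => t.
by rewrite /pval mevalD mevalZ.
Qed.

End RationalFunctions.

(** A point where [p] is nonzero and a point where [q] is nonzero are joined by a rational curve in
    [C]. Along it the numerators [P] and [Q] of [p] and [q] are nonzero polynomials, so at a nonroot
    of [h P Q] the product [p q] would not vanish. *)
Lemma irreducible_by_curves (F : fieldType) (charF0 : [pchar F] =i pred0)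
    (V : vectType F) (C : V -> Prop) :
    (forall x y, C x -> C y -> exists (h : {poly F}) (c : F -> V) t0 t1,
      [/\ ratcurve h c, forall t, h.[t] != 0 -> C (c t),
          h.[t0] != 0 /\ c t0 = x & h.[t1] != 0 /\ c t1 = y]) ->
  irreducible_set C.
Proof.
move=> curveC p q pq0; apply: NNPP => /not_or_and[np nq].
have nvanish (r : {mpoly F[\dim {:V}]}) :
    ~ vanishing_ideal C r -> exists2 v, C v & pval r v != 0.
  move=> nr; apply: NNPP => nex; apply: nr => v Cv; apply/eqP/negP => /negP rv.
  by apply: nex; exists v.
have [x Cx px] := nvanish p np; have [y Cy qy] := nvanish q nq.
have [h [c [t0 [t1 [cP cC [ht0 c0] [ht1 c1]]]]]] := curveC x y Cx Cy.
have [d [P PE]] := ratfun_pval p cP; have [e [Q QE]] := ratfun_pval q cP.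
have P0 : P != 0.
  apply: contraNneq px => P0; have /eqP := PE t0 ht0.
  by rewrite P0 horner0 mulf_eq0 expf_eq0 (negbTE ht0) andbF c0.
have Q0 : Q != 0.
  apply: contraNneq qy => Q0; have /eqP := QE t1 ht1.
  by rewrite Q0 horner0 mulf_eq0 expf_eq0 (negbTE ht1) andbF c1.
have h0 : h != 0 by apply: contraNneq ht0 => ->; rewrite horner0.
have [|t] := poly_nonroot charF0 (P := h * (P * Q)).
  by rewrite !mulf_neq0.
rewrite !hornerM mulf_eq0 negb_or => /andP[ht].
have /eqP := pq0 _ (cC t ht); rewrite mevalM -/(pval p _) -/(pval q _).
rewrite -PE // -QE // => /eqP pq; apply/negP; rewrite negbK.
by rewrite mulrACA pq mulr0.
Qed.

(** * Powers of the algebra and its annihilator *)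

Lemma endomorphismP (F : fieldType) (V : vectType F) (f : V -> V) :
  linear f -> exists g : 'End(V), forall x, g x = f x.
Proof.
move=> lin_f.
pose Lf := GRing.isLinear.Build F V V *:%R f lin_f.
pose f' : {linear V -> V} := HB.pack f Lf.
by exists (linfun f') => x; rewrite (lfunE f').
Qed.

Section Products.
Variables (F : fieldType) (N : vectType F) (mul : {bilinear N -> N -> N}).

Lemma prodDl x y z : mul (x + y) z = mul x z + mul y z.
Proof. by rewrite linearDl. Qed.
Lemma prodDr x y z : mul x (y + z) = mul x y + mul x z.
Proof. by rewrite linearDr. Qed.
Lemma prodBl x y z : mul (x - y) z = mul x z - mul y z.
Proof. by rewrite linearBl. Qed.
Lemma prodBr x y z : mul x (y - z) = mul x y - mul x z.
Proof. by rewrite linearBr. Qed.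
Lemma prodZl c x y : mul (c *: x) y = c *: mul x y.
Proof. by rewrite linearZl_LR. Qed.
Lemma prodZr c x y : mul x (c *: y) = c *: mul x y.
Proof. by rewrite linearZr_LR. Qed.
Lemma prod0l x : mul 0 x = 0.
Proof. by rewrite linear0l. Qed.
Lemma prod0r x : mul x 0 = 0.
Proof. by rewrite linear0r. Qed.

Lemma prods_ind (U V : {vspace N}) (P : N -> Prop) :
    P 0 -> (forall c x y, P x -> P y -> P (c *: x + y)) ->
    (forall u v, u \in U -> v \in V -> P (mul u v)) ->
  forall x, x \in prods mul U V -> P x.
Proof.
move=> P0 PD PM x.
rewrite /prods; set X := [seq mul u v | u <- _, v <- _] => Xx.
rewrite (@coord_span _ _ _ (in_tuple X) x Xx).
have PX i : (i < size X)%N -> P X`_i.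
  move=> lt_iX; have /allpairsP[[u v] /= [Uu Vv ->]] := mem_nth 0 lt_iX.
  by apply: PM; apply: vbasis_mem.
elim/big_rec: _ => // i y _ Py.
by apply: PD => //; apply: PX; case: i.
Qed.

Lemma pows_decr k : (pows mul k.+1 <= pows mul k)%VS.
Proof.
elim: k => [|[|k] IHk]; rewrite ?subvf //.
apply/prodspP => u v _ v_k; apply: memv_prods; first exact: memvf.
exact: subvP IHk _ v_k.
Qed.

Lemma pows_mono j k : (j <= k)%N -> (pows mul k <= pows mul j)%VS.
Proof.
move=> /subnK<-; elim: (k - j)%N => [|i IHi]; first exact: subvv.
by rewrite addSn; apply: subv_trans (pows_decr _) IHi.
Qed.

Lemma memv_pows_mulr k x y : y \in pows mul k.+1 -> mul x y \in pows mul k.+2.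
Proof. by move=> y_k; apply: memv_prods; rewrite ?memvf. Qed.

Lemma memv_pows_ideal k x y : y \in pows mul k -> mul x y \in pows mul k.
Proof.
case: k => [|k] y_k; first exact: memvf.
exact: subvP (pows_decr _) _ (memv_pows_mulr x y_k).
Qed.

Definition ideal (U : {vspace N}) := forall x y, y \in U -> mul x y \in U.

Lemma ideal_prods (mulA : forall x y z, mul x (mul y z) = mul (mul x y) z) U :
  ideal (prods mul fullv U).
Proof.
move=> x y; move: y; apply: prods_ind => [|c y z xy xz|u v _ Uv].
- by rewrite prod0r mem0v.
- by rewrite prodDr prodZr rpredD ?rpredZ.
- by rewrite mulA memv_prods ?memvf.
Qed.

(** Induction on [i]: for [x = u v] associativity gives [u (v y)], and multiplication by [u] raises
    the power by one. *)
Lemma memv_mul_pows (mulA : forall x y z, mul x (mul y z) = mul (mul x y) z)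
    i j x y :
  x \in pows mul i.+1 -> y \in pows mul j.+1 -> mul x y \in pows mul (i + j).+2.
Proof.
move=> + y_j; elim: i x => [|i IHi] x; first by move=> _; apply: memv_pows_mulr.
move: x; apply: prods_ind => [|c x z xy zy|u v _ v_i].
- by rewrite prod0l mem0v.
- by rewrite prodDl prodZl rpredD ?rpredZ.
- by rewrite -mulA; apply/memv_pows_mulr/IHi.
Qed.

End Products.

Section Nilpotent.
Variables (F : fieldType) (N : vectType F) (mul : {bilinear N -> N -> N}).
Hypothesis mulC : forall x y, mul x y = mul y x.
Hypothesis nilN : nilpotent_alg mul.

(** An element outside the annihilator has a nonzero multiple, which lies one power deeper;
    nilpotency ends the descent. In [main], [j] bounds the number of multiplications left. *)
Lemma ideal_meets_annihilator (U : {vspace N}) x :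
    ideal mul U -> x \in U -> x != 0 ->
  exists y, [/\ y \in U, y != 0 & y \in annihilator mul].
Proof.
move=> idU Ux x0; have [K powK] := nilN.
suff main j k z : (K <= j + k)%N -> z \in pows mul k.+1 -> z \in U -> z != 0 ->
    exists y, [/\ y \in U, y != 0 & y \in annihilator mul].
  by apply: (main K 0%N x); rewrite ?addn0 ?memvf.
elim: j k z {x Ux x0} => [|j IHj] k x leK x_k Ux x0.
  case/eqP: x0; apply/eqP.
  by rewrite -memv0 -powK; apply: subvP (pows_mono _ _) _ x_k.
have [ax|] := boolP (x \in annihilator mul); first by exists x.
move=> /annihilatorP nax; have [b xb] : exists b, mul x b != 0.
  apply: NNPP => nex; apply: nax => b; apply/eqP/negP => /negP xb.
  by apply: nex; exists b.
apply: (IHj k.+1 (mul b x)); first by rewrite -addSnnS.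
- exact: memv_pows_mulr.
- exact: idU.
- by rewrite mulC.
Qed.

Hypothesis ann1 : \dim (annihilator mul) = 1%N.

(** The annihilator is a line, hence spanned by the nonzero element of it found in [U]. *)
Lemma annihilator_sub_ideal (U : {vspace N}) :
  ideal mul U -> U != 0%VS -> (annihilator mul <= U)%VS.
Proof.
rewrite -subv0 => idU /subvPn[x Ux x0]; rewrite memv0 in x0.
have [y [Uy y0 ay]] := ideal_meets_annihilator idU Ux x0.
suff <- : <[y]>%VS = annihilator mul by rewrite -memvE.
by apply/eqP; rewrite eqEdim -memvE ay dim_vline y0 ann1.
Qed.

End Nilpotent.

(** * Derivations lifting functionals *)

Section Lift.
Variables (F : fieldType) (charF0 : [pchar F] =i pred0).
Variables (N : vectType F) (mul : {bilinear N -> N -> N}).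
Hypothesis mulA : forall x y z, mul x (mul y z) = mul (mul x y) z.
Hypothesis mulC : forall x y, mul x y = mul y x.
Variables (s : N) (w : 'Hom(N, F^o)).
Hypothesis s_mul : forall x, mul s x = 0.
Hypothesis s_ideal : forall U, ideal mul U -> U != 0%VS -> s \in U.
Hypothesis w_s : ev w s = 1.

Let n2 : 2%:R != 0 :> F. Proof. exact: (natS_neq0 charF0). Qed.
Let n3 : 3%:R != 0 :> F. Proof. exact: (natS_neq0 charF0). Qed.
Let n6 : 6%:R != 0 :> F. Proof. exact: (natS_neq0 charF0). Qed.

(** Otherwise the ideal [F x + N x] is nonzero and contains [s]; but [w] vanishes on it, while
    [w(s) = 1]. *)
Lemma nondegenerate x :
  (forall b, ev w (mul b x) = 0) -> ev w x = 0 -> x = 0.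
Proof.
move=> wbx wx; apply/eqP; case: eqVneq => // x0.
pose U := (<[x]> + prods mul fullv <[x]>)%VS.
have idU : ideal mul U.
  move=> b y /memv_addP[_ /vlineP[c ->] [z xz ->]].
  rewrite prodDr prodZr memvD //; last first.
    by apply: subvP (addvSr _ _) _ _; apply: ideal_prods.
  apply/memvZ/(subvP (addvSr _ _)).
  by apply: memv_prods; rewrite ?memvf ?memv_line.
have Ux : x \in U by apply: subvP (addvSl _ _) _ (memv_line x).
have U0 : U != 0%VS by apply: contraNneq x0 => U0; rewrite -memv0 -U0.
have /memv_addP[_ /vlineP[c ->] [z xz sE]] := s_ideal idU U0.
suff wz : ev w z = 0.
  by have /eqP := w_s; rewrite sE evD evZ wx wz mulr0 addr0 eq_sym oner_eq0.
move: z xz {sE}; apply: prods_ind => [|d y z wy wz|u v _ /vlineP[d ->]].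
- exact: ev0.
- by rewrite evD evZ wy wz mulr0 addr0.
- by rewrite prodZr evZ wbx mulr0.
Qed.

Lemma mul_eq0_ev k x :
    (forall b, b \in pows mul k -> ev w (mul b x) = 0) ->
  forall b, b \in pows mul k -> mul b x = 0.
Proof.
move=> wx b kb; apply: nondegenerate; last exact: wx.
by move=> c; rewrite mulA; apply/wx/memv_pows_ideal.
Qed.

(* The form ev w (mul b x) on N has the radical spanned by s; adding
   ev w b * ev w x makes it nondegenerate. *)
Lemma form_represents (G : N -> N -> F) :
    (forall b c x y, G b (c *: x + y) = c * G b x + G b y) ->
    (forall a c x y, G (c *: x + y) a = c * G x a + G y a) ->
  exists D : 'End(N),
    forall a b, ev w (mul b (D a)) + ev w b * ev w (D a) = G b a.
Proof.
move=> linr linl.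
pose e := vbasis {:N}.
pose beta b x := ev w (mul b x) + ev w b * ev w x.
(* [J] and [K] record the values of [beta] and [G] against a basis, so [D] has to solve
   [J D = K]. *)
have [J JE] : exists J : 'End(N), forall x,
    J x = \sum_(i < \dim {:N}) beta e`_i x *: e`_i.
  apply: endomorphismP => c x y; rewrite scaler_sumr -big_split /=.
  apply: eq_bigr => i _; rewrite scalerA -scalerDl; congr (_ *: _).
  by rewrite /beta prodDr prodZr !evD !evZ; ring.
have [K KE] : exists K : 'End(N), forall a,
    K a = \sum_(i < \dim {:N}) G e`_i a *: e`_i.
  apply: endomorphismP => c x y; rewrite scaler_sumr -big_split /=.
  by apply: eq_bigr => i _; rewrite scalerA -scalerDl linr.
have coord_e (f : 'I_(\dim {:N}) -> F) i :
    coord e i (\sum_j f j *: e`_j) = f i.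
  by rewrite coord_sum_free // (basis_free (vbasisP _)).
have betaE b x : beta b x = \sum_(i < \dim {:N}) coord e i b * beta e`_i x.
  rewrite {1}/beta [in LHS](coord_vbasisf b) -/e.
  have [f fE] : exists f : 'Hom(N, F^o), forall b, ev f b = beta b x.
    apply: linear_functionalP => c y z.
    by rewrite /beta prodDl prodZl !evD !evZ; ring.
  rewrite -/(beta _ _) -fE ev_sum; apply: eq_bigr => i _.
  by rewrite evZ fE.
(* For [x] in the kernel, pairing with [s] gives [w(x) = 0], and then [nondegenerate] applies. *)
have lkerJ : lker J == 0%VS.
  rewrite -subv0; apply/subvP => x; rewrite memv_ker JE => /eqP Jx.
  have beta0 b : beta b x = 0.
    rewrite betaE big1 // => i _.
    by rewrite -(coord_e (fun j => beta e`_j x)) Jx linear0 mulr0.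
  have wx : ev w x = 0.
    by have := beta0 s; rewrite /beta s_mul ev0 w_s mul1r add0r.
  rewrite memv0; apply/eqP/nondegenerate => // b.
  by have := beta0 b; rewrite /beta wx mulr0 addr0.
exists (J^-1 \o K)%VF => a b.
have JD : J ((J^-1 \o K)%VF a) = K a.
  by rewrite comp_lfunE -[LHS]comp_lfunE (lker0_compfV lkerJ) id_lfunE.
rewrite -/(beta b _) betaE.
have [f fE] : exists f : 'Hom(N, F^o), forall b, ev f b = G b a.
  exact: linear_functionalP.
rewrite -fE [in RHS](coord_vbasisf b) -/e ev_sum; apply: eq_bigr => i _.
rewrite evZ fE; congr (_ * _).
by rewrite -(coord_e (fun j => beta e`_j _)) -JE JD KE coord_e.
Qed.

Variable pi : 'End(N).
Hypothesis pi_N2 : forall x, x \in pows mul 2 -> pi x = 0.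
Hypothesis pi_mod : forall x, x - pi x \in pows mul 2.

(* For b of weight i and a of weight j, where elements of the complement of
   N^2 have weight 1 and elements of N^2 weight 2, this is j / (i + j) times
   ev mu (mul b a), except when both a and b are in N^2. *)
Definition euler_form (mu : 'Hom(N, F^o)) b a : F :=
  ev mu (mul b a) / 2%:R
  + (ev mu (mul (pi b) a) - ev mu (mul b (pi a))) / 6%:R.

Definition lifts (mu : 'Hom(N, F^o)) (D : 'End(N)) :=
  (forall a, ev w (D a) = ev mu a) /\
  (forall b a, ev w (mul b (D a)) = euler_form mu b a).

(** Either all products vanish, or [N^2] is a nonzero ideal containing [s], whence [pi s = 0].
    Together with [s_mul] this makes [euler_form] vanish at [b = s]. *)
Lemma mul_pi_s a : mul (pi s) a = 0.
Proof.
have [N2_0|N2_n0] := eqVneq (pows mul 2) 0%VS.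
  by apply/eqP; rewrite -memv0 -N2_0; apply: memv_prods; rewrite memvf.
by rewrite pi_N2 ?prod0l //; apply: s_ideal => //; apply: ideal_prods.
Qed.

(** The form represented is [euler_form] plus [w(b) mu(a)]. At [b = s] it yields [w(D a) = mu(a)],
    after which the added terms cancel. *)
Lemma lifts_exists mu : exists D, lifts mu D.
Proof.
have piP c x y : pi (c *: x + y) = c *: pi x + pi y by rewrite linearP.
have [||D DE] := form_represents (G := fun b a =>
    euler_form mu b a + ev w b * ev mu a).
- move=> b c x y; rewrite /euler_form !piP.
  by rewrite !prodDr !prodZr !evD !evZ; ring.
- move=> a c x y; rewrite /euler_form !piP.
  by rewrite !prodDl !prodZl !evD !evZ; ring.
have wD a : ev w (D a) = ev mu a.
  have := DE a s; rewrite w_s !mul1r /euler_form !s_mul mul_pi_s !ev0.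
  by rewrite subrr !mul0r !add0r.
by exists D; split=> // b a; have := DE a b; rewrite wD => /addIr.
Qed.

Lemma lifts_lin mu nu D E c :
  lifts mu D -> lifts nu E -> lifts (mu + c *: nu) (D + c *: E).
Proof.
move=> [wD bD] [wE bE]; split=> [a|b a];
  rewrite add_lfunE scale_lfunE ?prodDr ?prodZr evD evZ.
  by rewrite wD wE evDl evZl.
by rewrite bD bE /euler_form !evDl !evZl; ring.
Qed.

(** By [nondegenerate] the Leibniz defect is tested by [w] and by [w(b _)]. Under [w] the
    antisymmetric part of [euler_form] cancels and two halves of [mu(x y)] remain. Under [w(b _)]
    the term [D(x y)] contributes [2/3] of [mu(b x y)], each of the other two terms [1/3]. *)
Lemma lifts_derivation mu D :
    (forall x, x \in pows mul 4 -> ev mu x = 0) ->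
  lifts mu D -> is_derivation mul D.
Proof.
move=> mu4 [wD bD] x y.
have N2M u v : mul u v \in pows mul 2 by apply: memv_prods; rewrite memvf.
(* [t - pi t] lies in [N^2], and [N^2 N^2] lies in [N^4], where [mu] vanishes. *)
have mu_pi u v t : ev mu (mul (pi t) (mul u v)) = ev mu (mul t (mul u v)).
  apply/eqP; rewrite eq_sym -subr_eq0 -evB -prodBl mu4 //.
  exact: (memv_mul_pows mulA (i := 1) (j := 1)).
apply/eqP; rewrite -subr_eq0; apply/eqP/nondegenerate => [b|].
  rewrite !(prodBr, prodDr) !evB !evD bD.
  rewrite (mulC (D x) y) !(mulA b (_ : N) (D _)) !bD /euler_form.
  rewrite !(pi_N2 (N2M _ _)) !prod0l !prod0r !ev0 mu_pi.
  rewrite (mulC (mul b y) (pi x)) (mulC (mul b x) (pi y)) !mu_pi.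
  have -> : mul (mul b y) x = mul b (mul x y) by rewrite -mulA (mulC y).
  have -> : mul (mul b x) y = mul b (mul x y) by rewrite mulA.
  have -> : mul x (mul b y) = mul b (mul x y) by rewrite !mulA (mulC x).
  have -> : mul y (mul b x) = mul b (mul x y) by rewrite mulC -mulA.
  by field; rewrite ?n2 ?n3 ?n6.
rewrite evB evD wD (mulC (D x) y) !bD /euler_form (mulC y x).
rewrite (mulC (pi y)) (mulC y (pi x)).
by field; rewrite ?n2 ?n3 ?n6.
Qed.

Definition annihilated_by k x := forall b, b \in pows mul k -> mul b x = 0.

Hypothesis pi_S2 : forall x, annihilated_by 2 x -> annihilated_by 2 (pi x).

Lemma annihilated_line x : annihilated_by 1 x -> x = ev w x *: s.
Proof.
move=> ax; apply/eqP; rewrite -subr_eq0; apply/eqP/nondegenerate => [b|].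
  by rewrite prodBr prodZr ax ?memvf // mulC s_mul scaler0 subrr ev0.
by rewrite evB evZ w_s mulr1 subrr.
Qed.

Lemma lifts_socle mu D : lifts mu D -> D s = ev mu s *: s.
Proof.
move=> [wD bD]; apply/eqP; rewrite -subr_eq0; apply/eqP/nondegenerate => [b|].
  rewrite prodBr prodZr evB evZ bD /euler_form.
  rewrite (mulC _ s) s_mul (mulC _ s) s_mul (mulC b) mul_pi_s !ev0.
  by rewrite subrr !mul0r mulr0 addr0 subr0.
by rewrite evB evZ wD w_s mulr1 subrr.
Qed.

(** [mu] vanishes on [N^4] and on [Ann(N)]. For [b] in [N^3] the product [b y] is in [N^4]; for [b]
    in [N^2] and [y] in [Ann(N^3)], or [b] in [N] and [y] in [Ann(N^2)], it is in [Ann(N)]. So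
    [euler_form] vanishes in each case. *)
Lemma lifts_nilpotent mu D :
    (forall x, x \in pows mul 4 -> ev mu x = 0) -> ev mu s = 0 ->
  lifts mu D -> forall x, D (D (D (D x))) = 0.
Proof.
move=> mu4 mus liftD x; have [wD bD] := liftD.
have mu1 y : annihilated_by 1 y -> ev mu y = 0.
  by move/annihilated_line->; rewrite evZ mus mulr0.
have mul_pi b y : b \in pows mul 2 -> ev mu (mul b (pi y)) = ev mu (mul b y).
  move=> b2; apply/eqP; rewrite eq_sym -subr_eq0 -evB -prodBr mu4 //.
  exact: (memv_mul_pows mulA (i := 1) (j := 1)).
have D3 y : annihilated_by 3 (D y).
  apply: mul_eq0_ev => b b3; have b2 := subvP (pows_decr mul 2) b b3.
  have by4 z : mul b z \in pows mul 4 by rewrite mulC memv_pows_mulr.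
  by rewrite bD /euler_form pi_N2 // prod0l !mu4 ?mem0v // subrr !mul0r addr0.
have D2 y : annihilated_by 3 y -> annihilated_by 2 (D y).
  move=> y3; apply: mul_eq0_ev => b b2.
  rewrite bD /euler_form pi_N2 // prod0l mul_pi // mu1.
    by rewrite ev0 subrr !mul0r addr0.
  by move=> c _; rewrite mulA y3 // memv_pows_mulr.
(* For arbitrary [b] the term with [pi y] remains; [pi_S2] keeps [pi y] in [Ann(N^2)]. *)
have D1 y : annihilated_by 2 y -> annihilated_by 1 (D y).
  move=> y2; apply: mul_eq0_ev => b _.
  have muy z c : annihilated_by 2 z -> ev mu (mul c z) = 0.
    move=> z2; apply: mu1 => d _.
    by rewrite mulA z2 // memv_pows_mulr ?memvf.
  by rewrite bD /euler_form !muy ?subrr ?mul0r ?addr0 //; apply: pi_S2.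
have D0 y : annihilated_by 1 y -> D y = 0.
  move=> /annihilated_line->.
  by rewrite linearZ /= (lifts_socle liftD) mus scale0r scaler0.
exact/D0/D1/D2/D3.
Qed.

(** [(D - 1)(D - 2/3)(D - 1/2)(D - 1/3)] vanishes layer by layer: [y] lies in [Ann(N^2)], [z] in
    [N^2] plus the line of [s], and [t] on that line, where [D] is the identity. *)
Lemma lifts_euler D : pows mul 4 = 0%VS -> lifts w D ->
  D s = s /\ forall x, let y := D x - 3%:R^-1 *: x in
    let z := D y - 2%:R^-1 *: y in let t := D z - (2%:R / 3%:R) *: z in D t = t.
Proof.
move=> N4 liftD; have [wD bD] := liftD.
have mul22 b x : b \in pows mul 2 -> x \in pows mul 2 -> mul b x = 0.
  move=> b2 x2; apply/eqP; rewrite -memv0 -N4.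
  exact: (memv_mul_pows mulA (i := 1) (j := 1)).
have mul_pil b x : x \in pows mul 2 -> mul (pi b) x = mul b x.
  by move=> x2; apply/eqP; rewrite eq_sym -subr_eq0 -prodBl mul22.
have mul_pir b x : b \in pows mul 2 -> mul b (pi x) = mul b x.
  by move=> b2; rewrite !(mulC b) mul_pil.
have Ds : D s = s by rewrite (lifts_socle liftD) w_s scale1r.
split=> // x y.
(* For [b] in [N^2] the form equals [1/2 - 1/6 = 1/3] of [w(b x)]. *)
have y2 : annihilated_by 2 y.
  apply: mul_eq0_ev => b b2.
  rewrite prodBr prodZr evB evZ bD /euler_form pi_N2 // prod0l mul_pir // ev0.
  by field; rewrite ?n2 ?n3 ?n6.
have lineE u v : annihilated_by 1 (u - v) -> exists c, u = v + c *: s.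
  by move/annihilated_line=> uv; exists (ev w (u - v)); rewrite -uv addrC subrK.
(* On [N^2] the coefficient is [1/2 + 1/6 = 2/3]; products do not see the multiple of [s]. *)
have DN2 r : r \in pows mul 2 -> exists c, D r = (2%:R / 3%:R) *: r + c *: s.
  move=> r2; apply/lineE/mul_eq0_ev => b _.
  rewrite prodBr prodZr evB evZ bD /euler_form mul_pil // pi_N2 // prod0r ev0.
  by field; rewrite ?n2 ?n3 ?n6.
(* As [pi y] is in [Ann(N^2)], [(pi b)(pi y) = b (pi y)]: the terms over 6 cancel and [1/2] is
   left. *)
have [c1 Dpy] : exists c, D (pi y) = 2%:R^-1 *: pi y + c *: s.
  apply/lineE/mul_eq0_ev => b _.
  have -> : ev w (mul b (D (pi y) - 2%:R^-1 *: pi y)) =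
            ev w (mul b (D (pi y))) - 2%:R^-1 * ev w (mul b (pi y)).
    by rewrite prodBr prodZr evB evZ.
  have -> := bD b (pi y); rewrite /euler_form.
  have -> : pi (pi y) = pi y.
    by have /eqP := pi_N2 (pi_mod y); rewrite linearB subr_eq0 => /eqP <-.
  have -> : mul (pi b) (pi y) = mul b (pi y).
    by apply/eqP; rewrite eq_sym -subr_eq0 -prodBl pi_S2.
  by rewrite subrr mul0r addr0 mulrC subrr.
have [c2 Dr] := DN2 _ (pi_mod y); set r := y - pi y in Dr.
have yE : y = pi y + r by rewrite addrC subrK.
have r2 : r \in pows mul 2 := pi_mod y.
move=> z t.
(* [1/6 = 2/3 - 1/2], and the component [pi y] is gone up to a multiple of [s]. *)
have [c3 zE] : exists c, z = 6%:R^-1 *: r + c *: s.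
  exists (c1 + c2).
  have -> : z = D (pi y + r) - 2%:R^-1 *: (pi y + r) by rewrite -yE.
  rewrite linearD /= Dpy Dr.
  by apply: ev_inj => f; rewrite !evE; field; rewrite ?n2 ?n3 ?n6.
have [c4 tE] : exists c, t = c *: s.
  exists (6%:R^-1 * c2 + 3%:R^-1 * c3).
  rewrite /t zE linearD !linearZ /= Ds Dr.
  by apply: ev_inj => f; rewrite !evE; field; rewrite ?n2 ?n3 ?n6.
by rewrite tE linearZ /= Ds.
Qed.

End Lift.

(** * A projection along [N^2] compatible with [Ann(N^2)] *)

Section AdaptedProjection.
Variables (F : fieldType) (N : vectType F) (mul : {bilinear N -> N -> N}).
Hypothesis mulC : forall x y, mul x y = mul y x.

Definition annv (U : {vspace N}) : {vspace N} :=
  (\bigcap_(i < \dim U) lker (linfun (mul^~ (vbasis U)`_i)))%VS.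

Lemma annvP (U : {vspace N}) x :
  reflect (forall y, y \in U -> mul x y = 0) (x \in annv U).
Proof.
have linE y : linfun (mul^~ y) x = mul x y.
  by rewrite (@lfunE _ _ _ (applyr mul y)).
rewrite memvE; apply: (iffP subv_bigcapP) => [ann_x y Uy | ann_x i _].
  rewrite (coord_vbasis Uy) linear_sumr big1 // => i _.
  have := ann_x i isT; rewrite -memvE memv_ker linE => /eqP xi0.
  by rewrite linearZr_LR /= xi0 scaler0.
by rewrite -memvE memv_ker linE ann_x // vbasis_mem // mem_nth ?size_tuple.
Qed.

(** [U] is a complement of [A :&: N2] in [A], the annihilator of [N^2], and [V] is a complement of
    [N^2] containing [U]. The projection onto [V] along [N^2] maps [A] into [U], which is inside
    [A]. *)
Lemma adapted_projection : exists pi : 'End(N),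
  [/\ forall x, x \in pows mul 2 -> pi x = 0,
      forall x, x - pi x \in pows mul 2
    & forall x, annihilated_by mul 2 x -> annihilated_by mul 2 (pi x)].
Proof.
set N2 := pows mul 2; pose A := annv N2; pose U := (A :\: N2)%VS.
pose V := (U + (N2 + U)^C)%VS.
have U_N2 : (U :&: N2 = 0)%VS by apply: capv_diff.
have V_N2 : (V :&: N2 = 0)%VS.
  apply/eqP; rewrite -subv0; apply/subvP => x; rewrite memv_cap memv0.
  case/andP => /memv_addP[u Uu [c Cc ->]] ucN2.
  have c0 : c = 0.
    apply/eqP; rewrite -memv0 -(capv_compl (N2 + U)) memv_cap Cc andbT.
    by rewrite -[c](addKr u) addrC memv_add ?rpredN.
  by rewrite c0 addr0 in ucN2 *; rewrite -memv0 -U_N2 memv_cap Uu.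
have V_full x : x \in (V + N2)%VS.
  rewrite /V -addvA [(_ + N2)%VS]addvC addvA [(U + N2)%VS]addvC.
  by rewrite addv_complf memvf.
exists (daddv_pi V N2).
have piE x := daddv_pi_add V_N2 (V_full x).
have pi_mod x : x - daddv_pi V N2 x \in N2.
  by rewrite -{1}(piE x) addrC addKr memv_pi.
have pi_N2 x : x \in N2 -> daddv_pi V N2 x = 0.
  have N2_V : (N2 :&: V = 0)%VS by rewrite capvC.
  move=> x2; apply: (addIr (daddv_pi N2 V x)).
  by rewrite piE add0r daddv_pi_id.
split=> // x ax.
have Ax : x \in A by apply/annvP => y y2; rewrite mulC ax.
have : x \in (U + A :&: N2)%VS by rewrite addv_diff_cap.
case/memv_addP => u Uu [r]; rewrite memv_cap => /andP[_ r2] xE.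
rewrite xE linearD /= (pi_N2 r) // addr0 daddv_pi_id //; last first.
  by apply: subvP (addvSl _ _) _ Uu.
move=> b b2; rewrite mulC; apply/annvP: b b2.
by apply: subvP (diffvSl _ _) _ Uu.
Qed.

End AdaptedProjection.

(** * Exponentials of nilpotent derivations *)

Section Exponential.
Variables (F : fieldType) (charF0 : [pchar F] =i pred0).
Variables (N : vectType F) (mul : {bilinear N -> N -> N}).

Let n2 : 2%:R != 0 :> F. Proof. exact: (natS_neq0 charF0). Qed.
Let n3 : 3%:R != 0 :> F. Proof. exact: (natS_neq0 charF0). Qed.
Let n6 : 6%:R != 0 :> F. Proof. exact: (natS_neq0 charF0). Qed.

(* This is exp D only when D^4 = 0. *)
Definition exp4 (D : 'End(N)) : 'End(N) :=
  (\1 + D + 2%:R^-1 *: (D \o D) + 6%:R^-1 *: (D \o (D \o D)))%VF.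

Lemma exp4E D x :
  exp4 D x = x + D x + 2%:R^-1 *: D (D x) + 6%:R^-1 *: D (D (D x)).
Proof. by rewrite /exp4 !(add_lfunE, scale_lfunE, comp_lfunE, id_lfunE). Qed.

Lemma exp4NE D x :
  exp4 (- D) x = x - D x + 2%:R^-1 *: D (D x) - 6%:R^-1 *: D (D (D x)).
Proof. by rewrite exp4E !opp_lfunE !(linearN D) /= !opprK scalerN. Qed.

Section Nilpotent.
Variable D : 'End(N).
Hypothesis D4 : forall x, D (D (D (D x))) = 0.

Lemma exp4K x : exp4 (- D) (exp4 D x) = x.
Proof.
rewrite exp4NE exp4E !(linearD D, linearZ_LR D) /= !D4.
by apply: ev_inj => f; rewrite ?(linear0 D) !evE; field; rewrite ?n2 ?n3 ?n6.
Qed.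

Lemma exp4VK x : exp4 D (exp4 (- D) x) = x.
Proof.
rewrite exp4NE exp4E !(linearD D, linearN D, linearZ_LR D) /= !D4.
by apply: ev_inj => f; rewrite ?(linear0 D) !evE; field; rewrite ?n2 ?n3 ?n6.
Qed.

(** A polynomial formula for [D] in terms of [exp D] and its inverse: even powers cancel in the
    differences, the coefficient 8 cancels the cubes, and [16 - 4 = 12] is left. *)
Lemma exp4_log x :
  8%:R *: (exp4 D x - exp4 (- D) x)
  - (exp4 D (exp4 D x) - exp4 (- D) (exp4 (- D) x)) = 12%:R *: D x.
Proof.
rewrite !exp4NE !exp4E !(linearD D, linearN D, linearZ_LR D) /= !D4.
by apply: ev_inj => f; rewrite ?(linear0 D) !evE; field; rewrite ?n2 ?n3 ?n6.
Qed.

(** The terms [(D^i x)(D^j y)] of total degree above 3 have to cancel. The relations needed come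
    from [D^4(u v) = 0], expanded by the Leibniz rule in [e4]. *)
Lemma exp4_mul x y :
  is_derivation mul D -> exp4 D (mul x y) = mul (exp4 D x) (exp4 D y).
Proof.
move=> derD; apply: ev_inj => f.
have D2 u v : D (D (mul u v)) =
    mul (D (D u)) v + 2%:R *: mul (D u) (D v) + mul u (D (D v)).
  rewrite derD linearD /= !derD; apply: ev_inj => g; rewrite !evE; ring.
have D3 u v : D (D (D (mul u v))) = mul (D (D (D u))) v
    + 3%:R *: mul (D (D u)) (D v) + 3%:R *: mul (D u) (D (D v))
    + mul u (D (D (D v))).
  rewrite D2 !linearD !linearZ /= !derD.
  apply: ev_inj => g; rewrite !evE; ring.
have e4 u v : 4%:R * ev f (mul (D u) (D (D (D v))))
    + 6%:R * ev f (mul (D (D u)) (D (D v)))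
    + 4%:R * ev f (mul (D (D (D u))) (D v)) = 0.
  have := ev0 f; rewrite -{1}(D4 (mul u v)) D3 !linearD !linearZ /= !derD !D4.
  by rewrite prod0l prod0r !evE => <-; ring.
have p33 u v : ev f (mul (D (D (D u))) (D (D (D v)))) = 0.
  have := e4 (D u) (D v); rewrite !D4 prod0l prod0r ev0 !mulr0 addr0 add0r.
  by move=> /eqP; rewrite mulf_eq0 (negbTE n6) => /eqP.
have p23 u v : ev f (mul (D (D u)) (D (D (D v)))) = 0.
  have := e4 (D u) v; have := e4 u (D v).
  rewrite !D4 prod0l prod0r ev0 !mulr0 addr0 add0r.
  set a := ev f _; set b := ev f _ => e e'.
  (* The relations [6 a + 4 b = 0] and [4 a + 6 b = 0] have determinant 20, the successor of 19. *)
  apply: (mulfI (natS_neq0 charF0 19)); rewrite mulr0.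
  transitivity (6%:R * (6%:R * a + 4%:R * b) - 4%:R * (4%:R * a + 6%:R * b)).
    by ring.
  by rewrite e e' !mulr0 subr0.
have p32 u v : ev f (mul (D (D (D u))) (D (D v))) = 0.
  have := e4 u (D v); rewrite D4 prod0r p23 ev0 !mulr0 !add0r => /eqP.
  by rewrite mulf_eq0 (negbTE (natS_neq0 charF0 3)) => /eqP.
have p31 u v : ev f (mul (D (D (D u))) (D v)) = - ev f (mul (D u) (D (D (D v))))
    - 3%:R / 2%:R * ev f (mul (D (D u)) (D (D v))).
  apply: (mulfI (natS_neq0 charF0 3)); apply/eqP; rewrite -subr_eq0 -(e4 u v).
  by apply/eqP; field; rewrite ?n2 ?n3 ?n6.
rewrite !exp4E D3 D2 derD !(prodDl, prodDr, prodZl, prodZr) !evE.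
by rewrite p33 p23 p32 p31; field; rewrite ?n2 ?n3 ?n6.
Qed.

End Nilpotent.
End Exponential.

Lemma inv_lfun_unique (F : fieldType) (V : vectType F) (g h : 'End(V)) :
    (forall x, g (h x) = x) -> (forall x, h (g x) = x) ->
  bijective g /\ h = (g^-1)%VF.
Proof.
move=> gh hg; split; first by exists h.
have lg : lker g == 0%VS.
  rewrite -subv0; apply/subvP => x; rewrite memv_ker memv0 => /eqP gx.
  by rewrite -(hg x) gx linear0.
apply/lfunP => x.
by rewrite -{2}(gh x) -comp_lfunE (lker0_compVf lg) id_lfunE.
Qed.

(** * The torus generated by a derivation with eigenvalues among 2, 3, 4, 6 *)

Section Torus.
Variables (F : fieldType) (charF0 : [pchar F] =i pred0).
Variables (N : vectType F) (mul : {bilinear N -> N -> N}) (T : 'End(N)).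
Hypothesis derT : is_derivation mul T.
(* (T - 2) (T - 3) (T - 4) (T - 6) = 0, expanded *)
Hypothesis T4 : forall x, T (T (T (T x))) =
  15%:R *: T (T (T x)) - 80%:R *: T (T x) + 180%:R *: T x - 144%:R *: x.

Let nz n : n.+1%:R != 0 :> F. Proof. exact: (natS_neq0 charF0). Qed.

(* The product (T - a) (T - b) (T - c). *)
Definition cubic a b c : 'End(N) :=
  (T \o (T \o T) - (a + b + c) *: (T \o T) + (a * b + b * c + c * a) *: T
   - (a * b * c) *: \1)%VF.

Lemma cubicE a b c x : cubic a b c x = T (T (T x)) - (a + b + c) *: T (T x)
  + (a * b + b * c + c * a) *: T x - (a * b * c) *: x.
Proof.
by rewrite /cubic !(add_lfunE, opp_lfunE, scale_lfunE, comp_lfunE, id_lfunE).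
Qed.

(* The eigenprojectors of T, by Lagrange interpolation. *)
Definition proj2 := (- 8%:R^-1) *: cubic 3%:R 4%:R 6%:R.
Definition proj3 := 3%:R^-1 *: cubic 2%:R 4%:R 6%:R.
Definition proj4 := (- 4%:R^-1) *: cubic 2%:R 3%:R 6%:R.
Definition proj6 := 24%:R^-1 *: cubic 2%:R 3%:R 4%:R.

Definition torus (c : F) : 'End(N) :=
  c ^+ 2 *: proj2 + c ^+ 3 *: proj3 + c ^+ 4 *: proj4 + c ^+ 6 *: proj6.

Lemma torusE c x : torus c x = c ^+ 2 *: proj2 x + c ^+ 3 *: proj3 x
  + c ^+ 4 *: proj4 x + c ^+ 6 *: proj6 x.
Proof. by rewrite /torus !(add_lfunE, scale_lfunE). Qed.

Lemma weight_decomposition x : [/\ x = proj2 x + proj3 x + proj4 x + proj6 x,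
  T (proj2 x) = 2%:R *: proj2 x, T (proj3 x) = 3%:R *: proj3 x,
  T (proj4 x) = 4%:R *: proj4 x & T (proj6 x) = 6%:R *: proj6 x].
Proof.
rewrite /proj2 /proj3 /proj4 /proj6 !scale_lfunE !cubicE.
rewrite !(linearD T, linearN T, linearZ_LR T) /= T4.
split; apply: ev_inj => f; rewrite !evE; field; rewrite ?nz //.
Qed.

(** The list consists of the weights 2, 3, 4, 6 and their pairwise sums, which occur in products. A
    sum that is not itself one of these weights forces [z = 0] by [T4]. *)
Lemma torus_weight c n z : n \in [:: 2; 3; 4; 5; 6; 7; 8; 9; 10; 12]%N ->
  T z = n%:R *: z -> torus c z = c ^+ n *: z.
Proof.
move=> n_in Tz.
have Kz : ((n%:R - 2%:R) * (n%:R - 3%:R) * (n%:R - 4%:R) * (n%:R - 6%:R)) *: z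
    = 0.
  apply/eqP; rewrite -(subrr (T (T (T (T z))))) {2}T4 Tz !linearZ /= Tz.
  rewrite !linearZ /= Tz !linearZ /= Tz.
  by apply/eqP/ev_inj => f; rewrite !evE; ring.
have z0 m e : m.+1%:R *: z = 0 -> torus c z = e *: z.
  move/eqP; rewrite scaler_eq0 (negbTE (nz m)) => /eqP->.
  by rewrite linear0 scaler0.
have zN m e : - m.+1%:R *: z = 0 -> torus c z = e *: z.
  by rewrite scaleNr => /eqP; rewrite oppr_eq0 => /eqP; apply: z0.
have eig : torus c z =
    (c ^+ 2 * (- 8%:R^-1) * ((n%:R - 3%:R) * (n%:R - 4%:R) * (n%:R - 6%:R))
     + c ^+ 3 * 3%:R^-1 * ((n%:R - 2%:R) * (n%:R - 4%:R) * (n%:R - 6%:R))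
     + c ^+ 4 * (- 4%:R^-1) * ((n%:R - 2%:R) * (n%:R - 3%:R) * (n%:R - 6%:R))
     + c ^+ 6 * 24%:R^-1 * ((n%:R - 2%:R) * (n%:R - 3%:R) * (n%:R - 4%:R)))
    *: z.
  rewrite torusE /proj2 /proj3 /proj4 /proj6 !scale_lfunE !cubicE.
  rewrite Tz !linearZ /= Tz !linearZ /= Tz.
  by apply: ev_inj => f; rewrite !evE; field; rewrite ?nz.
move: n_in Kz eig {Tz}; rewrite !inE.
do !case/orP; move=> /eqP-> Kz eig.
- by rewrite eig; congr (_ *: _); field; rewrite ?nz.
- by rewrite eig; congr (_ *: _); field; rewrite ?nz.
- by rewrite eig; congr (_ *: _); field; rewrite ?nz.
(* The value of [(n - 2)(n - 3)(n - 4)(n - 6)] is [-6] here and [60, 240, 630, 1344, 4320] in the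
   last five cases; [zN] and [z0] take the predecessor of its absolute value. *)
- by apply: (zN 5); rewrite -[RHS]Kz; congr (_ *: _); ring.
- by rewrite eig; congr (_ *: _); field; rewrite ?nz.
- by apply: (z0 59); rewrite -[RHS]Kz; congr (_ *: _); ring.
- by apply: (z0 239); rewrite -[RHS]Kz; congr (_ *: _); ring.
- by apply: (z0 629); rewrite -[RHS]Kz; congr (_ *: _); ring.
- by apply: (z0 1343); rewrite -[RHS]Kz; congr (_ *: _); ring.
- by apply: (z0 4319); rewrite -[RHS]Kz; congr (_ *: _); ring.
Qed.

Lemma weight_ind (P : N -> Prop) :
    (forall x y, P x -> P y -> P (x + y)) ->
    (forall n x, n \in [:: 2; 3; 4; 6]%N -> T x = n%:R *: x -> P x) ->
  forall x, P x.
Proof.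
move=> PD PT x; have [xE T2 T3 T4' T6] := weight_decomposition x; rewrite xE.
by apply: (PD); [apply: (PD); [apply: (PD)|]|];
   [apply: (PT 2%N) | apply: (PT 3%N) | apply: (PT 4%N) | apply: (PT 6%N)].
Qed.

(** A derivation adds weights: for eigenvectors of weights [m] and [n] both sides are scaled by
    [c ^+ (m + n)]. *)
Lemma torus_mul c x y : torus c (mul x y) = mul (torus c x) (torus c y).
Proof.
elim/weight_ind: x => [x x' IHx IHx'|m x m_in Tx].
  by rewrite !(prodDl, linearD (torus c)) /= IHx IHx'.
elim/weight_ind: y => [y y' IHy IHy'|n y n_in Ty].
  by rewrite !(prodDr, linearD (torus c)) /= IHy IHy'.
have sub k : k \in [:: 2; 3; 4; 6]%N ->
    k \in [:: 2; 3; 4; 5; 6; 7; 8; 9; 10; 12]%N.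
  by rewrite !inE => /or4P[] /eqP->.
rewrite (torus_weight c (sub _ m_in) Tx) (torus_weight c (sub _ n_in) Ty).
rewrite prodZl prodZr scalerA -exprD; apply: torus_weight.
  by move: m_in n_in; rewrite !inE => /or4P[] /eqP-> /or4P[] /eqP->.
by rewrite derT Tx Ty prodZl prodZr -scalerDl natrD.
Qed.

Lemma torusK c x : c != 0 -> torus c (torus c^-1 x) = x.
Proof.
move=> c0; elim/weight_ind: x => [x y IHx IHy|n x n_in Tx].
  by rewrite !linearD /= IHx IHy.
have {}n_in : n \in [:: 2; 3; 4; 5; 6; 7; 8; 9; 10; 12]%N.
  by move: n_in; rewrite !inE => /or4P[] /eqP->.
rewrite (torus_weight c^-1 n_in Tx) linearZ /= (torus_weight c n_in Tx).
by rewrite scalerA -exprMn mulVf // expr1n scale1r.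
Qed.

End Torus.

(** [X] is a basis of a complement of [W], and [mu] gives the coordinates in it after projection
    along [W]. *)
Lemma dual_complement (F : fieldType) (N : vectType F) (W : {vspace N}) :
  exists (X : 'I_(\dim W^C) -> N) (mu : 'I_(\dim W^C) -> 'Hom(N, F^o)),
    (forall i j, ev (mu i) (X j) = (i == j)%:R) /\
    (forall i x, x \in W -> ev (mu i) x = 0).
Proof.
set C := (W^C)%VS; pose e := vbasis C; pose p := daddv_pi C W.
have CW : (C :&: W = 0)%VS by rewrite capvC capv_compl.
have /all_sig[mu muE] (i : 'I_(\dim C)) :
    {g : 'Hom(N, F^o) | forall x, ev g x = coord e i (p x)}.
  apply/constructive_indefinite_description/linear_functionalP => c x y.
  by rewrite !linearP.
exists (fun i => e`_i), mu; split=> [i j | i x Wx]; rewrite muE.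
  rewrite /p daddv_pi_id ?vbasis_mem ?mem_nth ?size_tuple //.
  by rewrite coord_free ?(basis_free (vbasisP _)) // eq_sym.
have WC : (W :&: C = 0)%VS by rewrite capvC.
suff -> : p x = 0 by rewrite linear0.
apply: (addIr (daddv_pi W C x)); rewrite daddv_pi_add //.
  by rewrite add0r daddv_pi_id.
by apply: subvP (addvSr _ _) _ Wx.
Qed.

(** * Curves and polynomial functions on endomorphisms *)

Section Curves.
Variables (F : fieldType) (h : {poly F}) (N : vectType F).

Lemma ratcurve_exp4 (c : F -> 'End(N)) :
  ratcurve h c -> ratcurve h (fun t => exp4 (c t)).
Proof.
move=> cP; rewrite /exp4.
have c2 := ratcurve_comp cP cP; have c3 := ratcurve_comp cP c2.
apply: ratcurveD; first apply: ratcurveD; first apply: ratcurveD => //.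
- exact: ratcurve_const.
- by apply: ratcurveZ => //; apply: ratfun_const.
- by apply: ratcurveZ => //; apply: ratfun_const.
Qed.

Lemma ratcurve_torus (T : 'End(N)) k :
  ratfun h k -> ratcurve h (fun t => torus T (k t)).
Proof.
move=> kP; rewrite /torus.
have P n (w : 'End(N)) : ratcurve h (fun t => k t ^+ n *: w).
  by apply: ratcurveZ; [apply: ratfunX | apply: ratcurve_const].
exact: ratcurveD (ratcurveD (ratcurveD (P _ _) (P _ _)) (P _ _)) (P _ _).
Qed.

Lemma ratcurve_segment (W : vectType F) (x y : W) :
  ratcurve h (fun t => x + t *: y).
Proof.
apply: ratcurveD; first exact: ratcurve_const.
by apply: (ratcurveZ (k := id)); [apply: ratfun_id | apply: ratcurve_const].
Qed.

End Curves.

Section PolynomialFunctions.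
Variables (F : fieldType) (N : vectType F).
Local Notation E2 := ('End(N) * 'End(N))%type.

Lemma polyfun_fst (g : 'Hom(N, F^o)) x : polyfun (fun u : E2 => ev g (u.1 x)).
Proof.
have [f fE] : exists f : 'Hom(E2, F^o), forall u, ev f u = ev g (u.1 x).
  apply: linear_functionalP => c u v /=.
  by rewrite add_lfunE scale_lfunE evD evZ.
by have [p pE] := polyfun_ev f; exists p => u; rewrite pE fE.
Qed.

Lemma polyfun_snd (g : 'Hom(N, F^o)) x : polyfun (fun u : E2 => ev g (u.2 x)).
Proof.
have [f fE] : exists f : 'Hom(E2, F^o), forall u, ev f u = ev g (u.2 x).
  apply: linear_functionalP => c u v /=.
  by rewrite add_lfunE scale_lfunE evD evZ.
by have [p pE] := polyfun_ev f; exists p => u; rewrite pE fE.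
Qed.

Lemma polyfun_square (pr : E2 -> 'End(N)) (g : 'Hom(N, F^o)) x :
    (forall f y, polyfun (fun u => ev f (pr u y))) ->
  polyfun (fun u : E2 => ev g (pr u (pr u x))).
Proof.
move=> prP; pose e := vbasis {:N}.
have [p pE] : polyfun (fun u : E2 =>
    \sum_(i < \dim {:N}) coord e i (pr u x) * ev g (pr u e`_i)).
  apply: polyfun_sum => i; apply: polyfunM (prP _ _).
  have [f fE] := coord_functional e i.
  by have [p pE] := prP f x; exists p => u; rewrite pE fE.
exists p => u; rewrite pE [in RHS](coord_vbasisf (pr u x)) linear_sum ev_sum.
by apply: eq_bigr => i _; rewrite linearZ evZ.
Qed.

Lemma polyfun_log (g : 'Hom(N, F^o)) x : polyfun (fun u : E2 =>
  ev g (8%:R *: (u.1 x - u.2 x) - (u.1 (u.1 x) - u.2 (u.2 x)))).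
Proof.
have P1 := polyfun_fst g x; have P2 := polyfun_snd g x.
have P11 := polyfun_square g x polyfun_fst.
have P22 := polyfun_square g x polyfun_snd.
have [p pE] := polyfunD
  (polyfunM (polyfun_const _ 8%:R)
     (polyfunD P1 (polyfunM (polyfun_const _ (-1)) P2)))
  (polyfunD (polyfunM (polyfun_const _ (-1)) P11) P22).
by exists p => u; rewrite pE !evE; ring.
Qed.

End PolynomialFunctions.

(** * Chains of irreducible sets of automorphisms *)

Section Families.
Variables (F : fieldType) (charF0 : [pchar F] =i pred0).
Variables (N : vectType F) (mul : {bilinear N -> N -> N}).
Hypothesis mulA : forall x y z, mul x (mul y z) = mul (mul x y) z.
Hypothesis mulC : forall x y, mul x y = mul y x.
Variables (s : N) (w : 'Hom(N, F^o)).
Hypothesis s_mul : forall x, mul s x = 0.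
Hypothesis s_ideal : forall U, ideal mul U -> U != 0%VS -> s \in U.
Hypothesis w_s : ev w s = 1.
Variable pi : 'End(N).
Hypothesis pi_N2 : forall x, x \in pows mul 2 -> pi x = 0.
Hypothesis pi_mod : forall x, x - pi x \in pows mul 2.
Hypothesis pi_S2 :
  forall x, annihilated_by mul 2 x -> annihilated_by mul 2 (pi x).

Local Notation lifts := (lifts mul w pi).

(** Lifts of the dual functionals are derivations, and they are independent because [w] composed
    with [D i] is [mu i]. *)
Lemma dim_der_ge : (\dim {:N} - \dim (pows mul 4) <= \dim (der mul))%N.
Proof.
rewrite -dimv_compl; have [X [mu [muX mu0]]] := dual_complement (pows mul 4).
have /all_sig[D liftD] i : {D | lifts (mu i) D}.
  apply: constructive_indefinite_description.
  exact: (lifts_exists mulA s_mul s_ideal w_s pi_N2).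
pose Y := [tuple D i | i < \dim (pows mul 4)^C].
have YE (i : 'I_(\dim (pows mul 4)^C)) : Y`_i = D i.
  by rewrite -[RHS](tnth_mktuple D) (tnth_nth 0).
have freeY : free Y.
  apply/freeP => k kY j.
  transitivity (ev w ((\sum_i k i *: Y`_i) (X j)));
    last by rewrite kY zero_lfunE ev0.
  rewrite sum_lfunE ev_sum (bigD1 j) //= big1 ?addr0 => [|i ij].
    by rewrite scale_lfunE evZ YE (liftD j).1 muX eqxx mulr1.
  rewrite scale_lfunE evZ YE (liftD i).1 muX.
  by rewrite (negbTE ij) mulr0.
have <- : \dim <<Y>> = \dim (pows mul 4)^C.
  by rewrite (eqP freeY) size_tuple.
apply: dimvS; apply/span_subvP => _ /mapP[i _ ->]; apply/derP.
exact: (lifts_derivation charF0 mulA mulC s_ideal w_s pi_N2 pi_mod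
         (mu0 i) (liftD i)).
Qed.

Variable W : {vspace N}.
Hypothesis W4 : (pows mul 4 <= W)%VS.
Hypothesis Ws : s \in W.
Variables (X : 'I_(\dim W^C) -> N) (mu : 'I_(\dim W^C) -> 'Hom(N, F^o)).
Hypothesis muX : forall i j, ev (mu i) (X j) = (i == j)%:R.
Hypothesis muW : forall i x, x \in W -> ev (mu i) x = 0.

(** A decreasing flag of functionals vanishing on [W]; by duality of [mu] and [X] each step up to
    [\dim W^C] lowers the dimension by one. *)
Definition flag (i : nat) (nu : 'Hom(N, F^o)) :=
  (forall x, x \in W -> ev nu x = 0) /\
  (forall j : 'I_(\dim W^C), (j < i)%N -> ev nu (X j) = 0).

Lemma flag_lin i nu nu' c : flag i nu -> flag i nu' -> flag i (nu + c *: nu').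
Proof.
move=> [nW nX] [nW' nX'].
split=> [x Wx|j ji]; rewrite evDl evZl.
  by rewrite nW // nW' // mulr0 addr0.
by rewrite nX // nX' // mulr0 addr0.
Qed.

Lemma flag0 i : flag i 0.
Proof. by split=> [x _|j _]; rewrite /ev zero_lfunE. Qed.

Lemma flag_lifts_nilpotent i nu D : flag i nu -> lifts nu D ->
  forall x, D (D (D (D x))) = 0.
Proof.
move=> [nW _] liftD.
apply: (lifts_nilpotent mulA mulC s_mul s_ideal w_s pi_N2 pi_mod pi_S2 _ _
         liftD).
  by move=> y y4; apply/nW/(subvP W4).
exact: nW.
Qed.

Lemma flag_lifts_derivation i nu D : flag i nu -> lifts nu D ->
  is_derivation mul D.
Proof.
move=> [nW _] liftD.
apply: (lifts_derivation charF0 mulA mulC s_ideal w_s pi_N2 pi_mod _ liftD).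
by move=> y y4; apply/nW/(subvP W4).
Qed.

Definition unipotent i (u : 'End(N) * 'End(N)) :=
  exists nu D, [/\ flag i nu, lifts nu D & u = (exp4 D, exp4 (- D))].

Lemma unipotent_aut i u : unipotent i u -> GL_embed (is_automorphism mul) u.
Proof.
move=> [nu [D [fnu liftD ->]]].
have D4 := flag_lifts_nilpotent fnu liftD.
have [bij inv] := inv_lfun_unique (exp4VK charF0 D4) (exp4K charF0 D4).
split=> //; split=> // x y; apply: exp4_mul => //.
exact: (flag_lifts_derivation fnu liftD).
Qed.

Lemma unipotent_nonempty i : exists u, unipotent i u.
Proof.
have [D liftD] := lifts_exists mulA s_mul s_ideal w_s pi_N2 0.
by exists (exp4 D, exp4 (- D)), 0, D; split=> //; apply: flag0.
Qed.

Lemma lifts_segment i nu nu' D D' t :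
    flag i nu -> flag i nu' -> lifts nu D -> lifts nu' D' ->
  exists nut, flag i nut /\ lifts nut (D + t *: (D' - D)).
Proof.
move=> fnu fnu' liftD liftD'; rewrite -scaleN1r.
exists (nu + t *: (nu' + (-1) *: nu)).
by split; [do 2?apply: flag_lin | do 2?apply: lifts_lin].
Qed.

Lemma ratcurve_exp4_segment h (D D' : 'End(N)) :
  ratcurve h (fun t => exp4 (D + t *: D')) /\
  ratcurve h (fun t => exp4 (- (D + t *: D'))).
Proof.
split; apply: ratcurve_exp4; first exact: ratcurve_segment.
apply: (ratcurve_linear (f := -%R)); last exact: ratcurve_segment.
by move=> c x y; rewrite opprD scalerN.
Qed.

(** Two members are joined by the exponential of the segment between their derivations, a polynomial
    curve, hence [h = 1]. *)
Lemma unipotent_irreducible i : irreducible_set (unipotent i).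
Proof.
apply: (irreducible_by_curves charF0).
move=> _ _ [nu [D [fnu liftD ->]]] [nu' [D' [fnu' liftD' ->]]].
pose Dt t := D + t *: (D' - D).
exists 1, (fun t => (exp4 (Dt t), exp4 (- Dt t))), 0, 1.
rewrite !hornerC oner_eq0; split=> //.
- have [c1 c2] := ratcurve_exp4_segment 1 D (D' - D).
  exact: ratcurve_pair.
- move=> t _; have [nut [fnut liftt]] := lifts_segment t fnu fnu' liftD liftD'.
  by exists nut, (Dt t).
- by rewrite /Dt scale0r addr0.
- by rewrite /Dt scale1r addrC subrK.
Qed.

(** By [exp4_log] the function takes the value [12 nu(X j)] on the pair attached to [nu]: this is 0
    on the smaller flag and 12 for [nu = mu j]. *)
Lemma unipotent_separated (i : nat) : (i < \dim W^C)%N ->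
  exists f, [/\ polyfun f, forall u, unipotent i.+1 u -> f u = 0
              & exists2 u, unipotent i u & f u != 0].
Proof.
move=> lt_i; pose j := Ordinal lt_i.
exists (fun u : 'End(N) * 'End(N) => ev w (8%:R *: (u.1 (X j) - u.2 (X j))
                       - (u.1 (u.1 (X j)) - u.2 (u.2 (X j))))).
have logE k nu D : flag k nu -> lifts nu D ->
    ev w (8%:R *: (exp4 D (X j) - exp4 (- D) (X j))
      - (exp4 D (exp4 D (X j)) - exp4 (- D) (exp4 (- D) (X j))))
    = 12%:R * ev nu (X j).
  move=> fnu liftD; rewrite exp4_log // ?evZ ?liftD.1 //.
  exact: (flag_lifts_nilpotent fnu liftD).
split; first exact: polyfun_log.
  move=> _ [nu [D [fnu liftD ->]]] /=; rewrite (logE _ _ _ fnu liftD).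
  by rewrite fnu.2 ?mulr0 /=.
have [D liftD] := lifts_exists mulA s_mul s_ideal w_s pi_N2 (mu j).
have fj : flag i (mu j).
  split=> [|k ki]; first exact: muW.
  by rewrite muX; case: eqVneq ki => // <- /=; rewrite ltnn.
exists (exp4 D, exp4 (- D)); first by exists (mu j), D.
by rewrite /= (logE _ _ _ fj liftD) muX eqxx mulr1 (natS_neq0 charF0).
Qed.

Lemma unipotent_decr i u : unipotent i.+1 u -> unipotent i u.
Proof.
move=> [nu [D [[nW nX] liftD ->]]]; exists nu, D; split=> //; split=> // j ji.
by apply: nX; apply: leqW.
Qed.

Lemma dim_aut_ge :
  le_enat (Some (\dim W^C)) (alg_group_dim (is_automorphism mul)).
Proof.
apply: (krull_dim_ge (C := unipotent)).
- by move=> i u _; apply: unipotent_aut.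
- by move=> i _; apply: unipotent_nonempty.
- by move=> i _; apply: unipotent_irreducible.
- by move=> i u _; apply: unipotent_decr.
- exact: unipotent_separated.
Qed.

(** * The additional torus step when [N^4 = 0] *)

Section WithTorus.
Hypothesis N4 : pows mul 4 = 0%VS.

Lemma euler_derivation : exists T : 'End(N),
  [/\ is_derivation mul T, T s = 6%:R *: s
    & forall x, T (T (T (T x))) =
  15%:R *: T (T (T x)) - 80%:R *: T (T x) + 180%:R *: T x - 144%:R *: x].
Proof.
have [D liftD] := lifts_exists mulA s_mul s_ideal w_s pi_N2 w.
have [Ds D4] := lifts_euler charF0 mulA mulC s_mul s_ideal w_s pi_N2 pi_mod
  pi_S2 N4 liftD.
(* The factor 6 turns the eigenvalues [1/3, 1/2, 2/3, 1] into the integers 2, 3, 4, 6. *)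
exists (6%:R *: D); split.
- have w4 x : x \in pows mul 4 -> ev w x = 0.
    by rewrite N4 memv0 => /eqP->; apply: ev0.
  have derD := lifts_derivation charF0 mulA mulC s_ideal w_s pi_N2 pi_mod
    w4 liftD.
  move=> x y.
  by rewrite !scale_lfunE derD scalerDr prodZl prodZr.
- by rewrite scale_lfunE Ds.
move=> x; have /= := D4 x.
rewrite !scale_lfunE !(linearZ_LR D, linearD D, linearN D) /=.
move=> D4x; apply: ev_inj => f.
have := congr1 (ev f) D4x; rewrite !evE => e.
have n2 := natS_neq0 charF0 1; have n3 := natS_neq0 charF0 2.
set d4 := ev f (D (D (D (D x)))) in e *; set d3 := ev f (D (D (D x))) in e *.
set d2 := ev f (D (D x)) in e *; set d1 := ev f (D x) in e *.
set d0 := ev f x in e *.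
have d4E : d4 = 5%:R / 2%:R * d3 - 20%:R / 9%:R * d2 + 5%:R / 6%:R * d1
    - 9%:R^-1 * d0.
  apply/eqP; rewrite -subr_eq0; apply/eqP.
  move/eqP: e; rewrite -subr_eq0 => /eqP <-.
  by field; rewrite ?n2 ?n3 ?(natS_neq0 charF0).
by rewrite d4E; field; rewrite ?(natS_neq0 charF0).
Qed.

Variable T : 'End(N).
Hypothesis derT : is_derivation mul T.
Hypothesis T_s : T s = 6%:R *: s.
Hypothesis T4 : forall x, T (T (T (T x))) =
  15%:R *: T (T (T x)) - 80%:R *: T (T x) + 180%:R *: T x - 144%:R *: x.

Definition toric (u : 'End(N) * 'End(N)) :=
  exists c nu D, [/\ c != 0, flag 0 nu, lifts nu D &
    u = (torus T c \o exp4 D, exp4 (- D) \o torus T c^-1)%VF].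

Lemma toric_aut u : toric u -> GL_embed (is_automorphism mul) u.
Proof.
move=> [c [nu [D [c0 fnu liftD ->]]]].
have D4 := flag_lifts_nilpotent fnu liftD.
have torusVK x : torus T c^-1 (torus T c x) = x.
  by have := torusK charF0 T4 (c := c^-1) x; rewrite invr_eq0 invrK; apply.
have [||bij inv] := @inv_lfun_unique _ _
    (torus T c \o exp4 D)%VF (exp4 (- D) \o torus T c^-1)%VF.
- by move=> x; rewrite !comp_lfunE exp4VK // torusK.
- by move=> x; rewrite !comp_lfunE torusVK exp4K.
split=> //; split=> // x y; rewrite !comp_lfunE exp4_mul ?torus_mul //.
exact: (flag_lifts_derivation fnu liftD).
Qed.

Lemma toric_irreducible : irreducible_set toric.
Proof.
apply: (irreducible_by_curves charF0).
move=> _ _ [c [nu [D [c0 fnu liftD ->]]]] [c' [nu' [D' [c0' fnu' liftD' ->]]]].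
pose Dt t := D + t *: (D' - D).
(* The affine function from [c] to [c'] is both torus parameter and denominator, so the parameter is
   nonzero wherever the curve has to lie in [toric]. *)
pose h := c%:P + (c' - c) *: 'X.
have hE t : h.[t] = c + (c' - c) * t by rewrite !hornerE.
exists h, (fun t => (torus T h.[t] \o exp4 (Dt t),
                     exp4 (- Dt t) \o torus T h.[t]^-1)%VF), 0, 1.
rewrite !hE mulr0 addr0 mulr1 [c + _]addrC subrK.
split=> //.
- have [c1 c2] := ratcurve_exp4_segment h D (D' - D).
  apply: ratcurve_pair; apply: ratcurve_comp => //; apply: ratcurve_torus.
    exact: ratfun_poly.
  exact: ratfunV.
- move=> t ht; have [nut [fnut liftt]] := lifts_segment t fnu fnu' liftD liftD'.
  by exists h.[t], nut, (Dt t).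
- by rewrite /Dt scale0r addr0.
- by rewrite /Dt scale1r [D + _]addrC subrK.
Qed.

Lemma torus_s c : torus T c s = c ^+ 6 *: s.
Proof. exact: torus_weight. Qed.

Lemma torus1 x : torus T 1 x = x.
Proof.
elim/(weight_ind charF0 T4): x => [x y IHx IHy|n x n_in Tx].
  by rewrite linearD /= IHx IHy.
rewrite (torus_weight charF0 T4 _ _ Tx) ?expr1n ?scale1r //.
by move: n_in; rewrite !inE => /or4P[] /eqP->.
Qed.

Lemma unipotent_toric u : unipotent 0 u -> toric u.
Proof.
move=> [nu [D [fnu liftD ->]]]; exists 1, nu, D.
split=> //; first exact: oner_neq0.
by congr pair; apply/lfunP => x; rewrite comp_lfunE ?invr1 torus1.
Qed.

Lemma exp4_s i nu D : flag i nu -> lifts nu D -> exp4 D s = s.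
Proof.
move=> [nW _] liftD; rewrite exp4E.
rewrite (lifts_socle mulA mulC s_mul s_ideal w_s pi_N2 liftD) nW // scale0r.
by rewrite !(linear0 D) !scaler0 !addr0.
Qed.

(** Unipotent members fix [s], while [torus T c] scales it by [c ^+ 6]; for [c = 2] the function has
    the value [64 - 1]. *)
Lemma toric_separated : exists f, [/\ polyfun f,
  forall u, unipotent 0 u -> f u = 0 & exists2 u, toric u & f u != 0].
Proof.
exists (fun u : 'End(N) * 'End(N) => ev w (u.1 s) + (-1)); split.
- exact: polyfunD (polyfun_fst w s) (polyfun_const _ _).
- move=> _ [nu [D [fnu liftD ->]]] /=.
  by rewrite (exp4_s fnu liftD) w_s subrr.
have [D liftD] := lifts_exists mulA s_mul s_ideal w_s pi_N2 0.
exists (torus T 2%:R \o exp4 D, exp4 (- D) \o torus T 2%:R^-1)%VF.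
  exists 2%:R, 0, D; split=> //; [exact: natS_neq0 | exact: flag0].
rewrite /= comp_lfunE (exp4_s (flag0 0) liftD) torus_s evZ w_s mulr1.
by rewrite -natrX -(natrB _ (isT : 1 <= 64)%N) (natS_neq0 charF0).
Qed.

Lemma dim_aut_ge_torus :
  le_enat (Some (\dim W^C).+1) (alg_group_dim (is_automorphism mul)).
Proof.
(* [toric] comes first, which shifts [unipotent j] to index [j.+1] and lengthens the chain by
   one. *)
apply: (krull_dim_ge (C := fun i => if i is j.+1 then unipotent j else toric)).
- by move=> [|i] u _; [apply: toric_aut | apply: unipotent_aut].
- move=> [|i] _; last exact: unipotent_nonempty.
  by have [u /unipotent_toric] := unipotent_nonempty 0; exists u.
- by move=> [|i] _; [apply: toric_irreducible | apply: unipotent_irreducible].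
- by move=> [|i] u _; [apply: unipotent_toric | apply: unipotent_decr].
- move=> [|i] i_d; first exact: toric_separated.
  exact: unipotent_separated.
Qed.

End WithTorus.
End Families.

Theorem mainTheorem11 (F : fieldType) (charF0 : [pchar F] =i pred0)
    (N : vectType F) (mul : {bilinear N -> N -> N}) (admN : admissible mul) :
  le_enat (Some (\dim {:N} - \dim (pows mul 4))%N)
          (alg_group_dim (is_automorphism mul)) /\
  (\dim {:N} - \dim (pows mul 4) <= \dim (der mul))%N.
Proof.
have [mulA mulC nilN ann1] := admN.
pose s := vpick (annihilator mul).
have s_ann : s \in annihilator mul by apply: memv_pick.
have s0 : s != 0 by rewrite vpick0 -dimv_eq0 ann1.
have s_mul := annihilatorP mul s s_ann.
have s_ideal (U : {vspace N}) : ideal mul U -> U != 0%VS -> s \in U.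
  move=> idU U0; apply: subvP s_ann.
  exact: (annihilator_sub_ideal mulC nilN ann1).
have [w w_s] : exists w : 'Hom(N, F^o), ev w s = 1.
  have [g gs] : exists g : 'Hom(N, F^o), ev g s != 0.
    apply: NNPP => nex; case/eqP: s0; apply: ev_inj => g; rewrite ev0.
    by apply/eqP; apply/negPn/negP => gs; apply: nex; exists g.
  by exists ((ev g s)^-1 *: g); rewrite evZl mulVf.
have [pi [pi_N2 pi_mod pi_S2]] := adapted_projection mulC.
split; last first.
  exact: (dim_der_ge charF0 mulA mulC s_mul s_ideal w_s pi_N2 pi_mod).
have [N4|N4] := eqVneq (pows mul 4) 0%VS.
  (* Here [W] is the annihilator line, and the torus step makes up for its dimension. *)
  have [X [mu [muX mu0]]] := dual_complement (annihilator mul).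
  have [T [derT T_s T4]] := euler_derivation charF0 mulA mulC s_mul s_ideal w_s
    pi_N2 pi_mod pi_S2 N4.
  have := dim_aut_ge_torus charF0 mulA mulC s_mul s_ideal w_s pi_N2 pi_mod
    pi_S2 _ s_ann muX mu0 derT T_s T4.
  have := dimvS (subvf (annihilator mul)).
  rewrite N4 sub0v dimv0 dimv_compl ann1 subn0 => n_gt0.
  by rewrite subn1 prednK //; apply.
(* Otherwise [N^4] is a nonzero ideal, so it contains [s] and serves as [W]. *)
have [X [mu [muX mu0]]] := dual_complement (pows mul 4).
have s4 : s \in pows mul 4 by apply: s_ideal => //; apply: ideal_prods.
have := dim_aut_ge charF0 mulA mulC s_mul s_ideal w_s pi_N2 pi_mod pi_S2
  (subvv _) s4 muX mu0.
by rewrite dimv_compl.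
Qed.
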